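(* Let $\rho>0$ and, for each $x\in\mathsf X$ and $m\in\{0,\dots,M\}$, let $$\widehat W_{x,m}(h_{x,1:m})=\rho\log\Big(\sum_{u\in\mathsf U}\exp\Big(-\frac1\rho\sum_{i=1}^m\sum_{s\in\mathcal T_i}h_{x,s}(u)\Big)\Big)+\frac{2L^2}{\rho}\sum_{j=m+1}^M\tau_j^2,\qquad L=L(\mathsf X,\mathsf U,\mathcal F).$$ Then for every $x\in\mathsf X$ the sequence $\{\widehat W_{x,m}\}_{m=0}^M$ is an admissible relaxation in phases at state $x$, and it leads to the following Markov policy for phase $m$: $$P_m(u|x)=\frac{\nu_1(u)\exp\big(-\frac1\rho\sum_{i=1}^{m-1}\sum_{s\in\mathcal T_i}h_{x,s}(u)\big)}{\big\langle\nu_1,\exp\big(-\frac1\rho\sum_{i=1}^{m-1}\sum_{s\in\mathcal T_i}h_{x,s}\big)\big\rangle},$$ where $\nu_1$ is the uniform distribution on $\mathsf U$; that is, for every $x\in\mathsf X$, $m\in\{1,\dots,M\}$ and every $h_{x,1:m-1}\in\mathcal H_x^{\tau_{1:m-1}}$, $$\sup_{h_x^m\in\mathcal H_x^{\tau_m}}\Big\{\mathbb E_{U\sim P_m(\cdot|x)}\Big[\sum_{s\in\mathcal T_m}h_{x,s}(U)\Big]+\widehat W_{x,m}(h_{x,1:m-1},h_x^m)\Big\}\le\widehat W_{x,m-1}(h_{x,1:m-1}).$$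
   Context: $\mathsf X,\mathsf U$ are finite nonempty sets (states, actions); $K(y|x,u)$ is a transition kernel; $\mathcal P(\mathsf U)$ is the set of probability distributions on $\mathsf U$; $\mathcal M(\mathsf U|\mathsf X)$ is the set of Markov matrices $P=[P(u|x)]$, $P(\cdot|x)\in\mathcal P(\mathsf U)$; $K(y|x,P)=\sum_uK(y|x,u)P(u|x)$ is assumed to have a unique invariant distribution $\pi_P$ for every $P\in\mathcal M(\mathsf U|\mathsf X)$. $(\pi\otimes P)(x,u)=\pi(x)P(u|x)$; $\langle\nu,f\rangle$ is the expectation of $f$ under $\nu$. $\mathcal F$ is a fixed nonempty class of functions $\mathsf X\times\mathsf U\to\mathbb R$; $T\ge1$ is a fixed horizon. $\widehat Q:\mathsf X\times\mathsf U\to\mathbb R$ satisfies the reverse Poisson inequality for $P$ with forcing function $g$ if for all $(x,u)$ $$\sum_yK(y|x,u)\widehat Q(y,P)-\widehat Q(x,u)\ge -g(x,u)+\langle\pi_P\otimes P,g\rangle,\qquad \widehat Q(y,P)=\sum_{u'}P(u'|y)\widehat Q(y,u').$$ Standing assumption: for every $P\in\mathcal M(\mathsf U|\mathsf X)$ and $f\in\mathcal F$ there is a (fixed choice of) function $\widehat Q_{P,f}$ satisfying the reverse Poisson inequality for $P$ with forcing function $f$, and $L(\mathsf X,\mathsf U,\mathcal F)=\sup_{P}\sup_{f\in\mathcal F}\|\widehat Q_{P,f}\|_\infty<\infty$. $\mathcal H_x=\{\widehat Q_{P,f}(x,\cdot):P\in\mathcal M(\mathsf U|\mathsf X),f\in\mathcal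 F\}$. Phases: $\{1,\dots,T\}$ is partitioned into consecutive nonempty contiguous intervals $\mathcal T_1,\dots,\mathcal T_M$ of lengths $\tau_1,\dots,\tau_M$; $\tau_{1:m}=\tau_1+\dots+\tau_m$, $\tau_{1:0}=0$, $\tau_{1:M}=T$. Write $h_x^m=(h_{x,s}:s\in\mathcal T_m)\in\mathcal H_x^{\tau_m}$ and $h_{x,1:m}=(h_{x,1},\dots,h_{x,\tau_{1:m}})$. A sequence $\widehat W_{x,m}:\mathcal H_x^{\tau_{1:m}}\to\mathbb R$, $m=0,\dots,M$, is an admissible relaxation in phases at state $x$ if for all sequences $h_{x,1},\dots,h_{x,T}\in\mathcal H_x$ $$\widehat W_{x,M}(h_{x,1:M})\ge-\inf_{\nu\in\mathcal P(\mathsf U)}\mathbb E_{U\sim\nu}\Big[\sum_{t=1}^Th_{x,t}(U)\Big],$$ $$\widehat W_{x,m}(h_{x,1:m})\ge\inf_{\nu\in\mathcal P(\mathsf U)}\sup_{h_x^{m+1}\in\mathcal H_x^{\tau_{m+1}}}\Big\{\mathbb E_{U\sim\nu}\Big[\sum_{s\in\mathcal T_{m+1}}h_{x,s}(U)\Big]+\widehat W_{x,m+1}(h_{x,1:m},h_x^{m+1})\Big\},\quad m=M-1,\dots,0.$$ *)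

(* Defs.v *)
From HB Require Import structures.
From mathcomp Require Import all_boot all_order all_algebra.
From mathcomp Require Import all_classical all_reals all_analysis.

Set Implicit Arguments.
Unset Strict Implicit.
Unset Printing Implicit Defensive.

Import Order.TTheory GRing.Theory Num.Theory.

Local Open Scope classical_set_scope.
Local Open Scope ring_scope.

Definition distributions (R : realType) (A : finType) : set (A -> R) :=
  [set p | (forall a, 0 <= p a) /\ \sum_a p a = 1].

Definition expect (R : realType) (A : finType) (nu f : A -> R) : R :=
  \sum_a nu a * f a.

Definition uniform_distribution (R : realType) (A : finType) : A -> R :=
  fun=> #|A|%:R^-1.

(** [P x u] stands for P(u|x), and [K x u y] for K(y|x,u). *)
Definition markov_matrices (R : realType) (X U : finType) :
    set (X -> U -> R) :=
  [set P | forall x, distributions (P x)].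

Definition transition_kernel (R : realType) (X U : finType)
    (K : X -> U -> X -> R) : Prop :=
  forall x u, distributions (K x u).

Definition induced_kernel (R : realType) (X U : finType)
    (K : X -> U -> X -> R) (P : X -> U -> R) (x y : X) : R :=
  \sum_u K x u y * P x u.

Definition invariant_distribution (R : realType) (X U : finType)
    (K : X -> U -> X -> R) (P : X -> U -> R) (p : X -> R) : Prop :=
  distributions p /\
  forall y, \sum_x p x * induced_kernel K P x y = p y.

Definition state_action (R : realType) (X U : finType)
    (p : X -> R) (P : X -> U -> R) : X * U -> R :=
  fun z => p z.1 * P z.1 z.2.

Definition policy_average (R : realType) (X U : finType)
    (Q : X * U -> R) (P : X -> U -> R) (y : X) : R :=
  \sum_u P y u * Q (y, u).

(** [p] is the invariant distribution of [P]. *)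
Definition reverse_poisson (R : realType) (X U : finType)
    (K : X -> U -> X -> R) (P : X -> U -> R) (p : X -> R)
    (g Q : X * U -> R) : Prop :=
  forall x u,
    \sum_y K x u y * policy_average Q P y - Q (x, u)
      >= - g (x, u) + expect (state_action p P) g.

Definition sup_norm (R : realType) (A : finType) (f : A -> R) : R :=
  \big[Num.max/0]_a `|f a|.

(** L(X,U,F), as an extended real, for the selection [Q P f] of solutions. *)
Definition sup_Q (R : realType) (X U : finType) (F : set (X * U -> R))
    (Q : (X -> U -> R) -> (X * U -> R) -> X * U -> R) : \bar R :=
  ereal_sup [set ereal_sup [set (sup_norm (Q P f))%:E | f in F]
            | P in @markov_matrices R X U].

Definition Q_rows (R : realType) (X U : finType) (F : set (X * U -> R))
    (Q : (X -> U -> R) -> (X * U -> R) -> X * U -> R) (x : X) :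
    set (U -> R) :=
  [set h | exists P f, [/\ @markov_matrices R X U P, F f &
                          h = fun u => Q P f (x, u)]].

(** Phases and times are numbered from 1; only [tau 1], ..., [tau M] matter.
    The total length of the first [m] phases is defined by recursion so that
    the concatenation of a [cumul tau m]-tuple with a [tau m.+1]-tuple is, by
    conversion, a [cumul tau m.+1]-tuple. *)
Fixpoint cumul (tau : nat -> nat) (m : nat) : nat :=
  if m is k.+1 then (cumul tau k + tau k.+1)%N else 0%N.

Definition phase_lengths (T M : nat) (tau : nat -> nat) : Prop :=
  (forall m, (1 <= m <= M)%N -> (0 < tau m)%N) /\ cumul tau M = T.

Definition phase (tau : nat -> nat) (m : nat) : seq nat :=
  index_iota (cumul tau m.-1).+1 (cumul tau m).+1.

(** The function h_s, for 1 <= s <= n. *)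
Definition at_time (R : realType) (U : finType) (n : nat)
    (h : n.-tuple (U -> R)) (s : nat) : U -> R :=
  nth (fun=> 0) h s.-1.

Definition sequences_in (R : realType) (U : finType) (H : set (U -> R))
    (n : nat) : set (n.-tuple (U -> R)) :=
  [set h | forall i, H (tnth h i)].

(** The expression in braces in the recursive admissibility condition for
    phase [m.+1], given the history [h] of the first [m] phases. *)
Definition phase_value (R : realType) (U : finType) (tau : nat -> nat)
    (W : forall m, (cumul tau m).-tuple (U -> R) -> R) (m : nat)
    (h : (cumul tau m).-tuple (U -> R)) (nu : U -> R)
    (g : (tau m.+1).-tuple (U -> R)) : R :=
  let hg : (cumul tau m.+1).-tuple (U -> R) := cat_tuple h g in
  expect nu (fun u => \sum_(s <- phase tau m.+1) at_time hg s u) + W m.+1 hg.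

Definition worst_phase_value (R : realType) (U : finType) (H : set (U -> R))
    (tau : nat -> nat) (W : forall m, (cumul tau m).-tuple (U -> R) -> R)
    (m : nat) (h : (cumul tau m).-tuple (U -> R)) (nu : U -> R) : \bar R :=
  ereal_sup [set (phase_value W h nu g)%:E
            | g in @sequences_in R U H (tau m.+1)].

(** [W m] is only constrained on tuples with entries in [H]. *)
Definition admissible_relaxation (R : realType) (U : finType)
    (H : set (U -> R)) (M : nat) (tau : nat -> nat)
    (W : forall m, (cumul tau m).-tuple (U -> R) -> R) : Prop :=
  (forall h, sequences_in H h ->
    (- ereal_inf [set (expect nu (fun u =>
                         \sum_(1 <= t < (cumul tau M).+1) at_time h t u))%:E
                 | nu in @distributions R U]
     <= (W M h)%:E)%E) /\
  (forall m, (m < M)%N -> forall h, sequences_in H h ->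
    (ereal_inf [set worst_phase_value H W h nu | nu in @distributions R U]
     <= (W m h)%:E)%E).

Definition exp_weight (R : realType) (U : finType) (rho : R)
    (tau : nat -> nat) (m : nat) (h : (cumul tau m).-tuple (U -> R))
    (u : U) : R :=
  expR (- (1 / rho) *
        \sum_(1 <= i < m.+1) \sum_(s <- phase tau i) at_time h s u).

Definition exp_relaxation (R : realType) (U : finType) (rho L : R) (M : nat)
    (tau : nat -> nat) (m : nat) (h : (cumul tau m).-tuple (U -> R)) : R :=
  rho * ln (\sum_u exp_weight rho h u)
  + 2 * L ^+ 2 / rho * \sum_(m.+1 <= j < M.+1) (tau j)%:R ^+ 2.

(** The row of the policy for phase [m.+1], given the history [h] of the
    first [m] phases. *)
Definition exp_policy (R : realType) (U : finType) (rho : R)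
    (tau : nat -> nat) (m : nat) (h : (cumul tau m).-tuple (U -> R))
    (u : U) : R :=
  @uniform_distribution R U u * exp_weight rho h u
  / expect (@uniform_distribution R U) (exp_weight rho h).

(* Main.v *)
(** The policy of phase m is the exponential-weights distribution p built from
    the past, and passing to the next phase multiplies the partition function
    by the moment generating function E_p[exp(-S/rho)] of the phase sum S,
    where |S| <= tau L.  By Hoeffding's lemma for the centered
    variable (E_p S - S)/rho, which is bounded by 2 tau L / rho, its logarithm
    is at most -E_p S/rho + 2 tau^2 L^2/rho^2; the last term is what the
    relaxation reserves for the phase.  The terminal condition holds because
    rho log(sum_u exp(-S u/rho)) dominates each -S u. *)

Require Import Defs.
From HB Require Import structures.
From mathcomp Require Import all_boot all_order all_algebra.
From mathcomp Require Import all_classical all_reals all_analysis.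
From mathcomp Require Import ring lra.

Set Implicit Arguments.
Unset Strict Implicit.
Unset Printing Implicit Defensive.

Import Order.TTheory GRing.Theory Num.Theory.
Import numFieldNormedType.Exports.

Local Open Scope classical_set_scope.
Local Open Scope ring_scope.

(** * Hoeffding's lemma for finite distributions, and its use on a log-partition function *)

Lemma ge0_is_derive_le (R : realType) (f df : R -> R) (b : R) :
  0 <= b -> (forall x : R, is_derive x 1 f (df x)) ->
  (forall x, 0 <= x -> 0 <= df x) -> f 0 <= f b.
Proof.
move=> b0 fdf df0.
have [x|c cab e] := MVT_segment b0 (fun x _ => fdf x).
  apply: continuous_subspaceT => y.
  apply/differentiable_continuous/derivable1_diffP.
  by have [] := fdf y.
move: cab; rewrite in_itv => /andP[c0 _].
by rewrite -subr_ge0 e subr0 mulr_ge0 ?df0.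
Qed.

Lemma cosh_le_expR (R : realType) (b : R) :
  0 <= b -> expR b + expR (- b) <= 2 * expR (b ^+ 2 / 2).
Proof.
(* [2 cosh y * exp (- y^2/2)] is nonincreasing since [sinh y <= y cosh y]. *)
move=> b0.
have sinh_le (x : R) : 0 <= x ->
    0 <= x * (expR x + expR (- x)) - (expR x - expR (- x)).
  move=> x0.
  pose f (y : R) := y * (expR y + expR (- y)) - (expR y - expR (- y)).
  have df (y : R) : is_derive y 1 f (y * (expR y - expR (- y))).
    rewrite /f; apply: is_derive_eq.
    by rewrite /GRing.scale /=; ring.
  have := ge0_is_derive_le x0 df; rewrite /f mul0r oppr0 subrr subr0; apply.
  by move=> y y0; rewrite mulr_ge0// subr_ge0 ler_expR; lra.
(* The sign makes this function nondecreasing on the half-line, as [ge0_is_derive_le] requires; its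
   value at 0 is -2. *)
pose f (y : R) := - ((expR y + expR (- y)) * expR (- (y ^+ 2 / 2))).
have df (y : R) : is_derive y 1 f
   ((y * (expR y + expR (- y)) - (expR y - expR (- y)))
    * expR (- (y ^+ 2 / 2))).
  rewrite /f; apply: is_derive_eq.
  by rewrite /GRing.scale /=; field.
have df0 (y : R) : 0 <= y ->
    0 <= (y * (expR y + expR (- y)) - (expR y - expR (- y)))
      * expR (- (y ^+ 2 / 2)).
  by move=> y0; rewrite mulr_ge0 ?expR_ge0// sinh_le.
have := ge0_is_derive_le b0 df df0.
rewrite /f expr0n/= mul0r oppr0 !expR0 mulr1 lerN2 [expR (- (_ / _))]expRN.
by rewrite ler_pdivrMr ?expR_gt0.
Qed.

Lemma expR_le_chord (R : realType) (b y : R) : `|y| <= b ->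
  2 * b * expR y <= (b + y) * expR b + (b - y) * expR (- b).
Proof.
rewrite ler_norml => /andP[by1 by2].
(* [y] is the average of [b] and [- b] with weights [b + y] and [b - y]: the
   tangent line at [y] lies below [expR] at both end points. *)
have t1 : (1 + (b - y)) * expR y <= expR b.
  by rewrite -[X in _ <= expR X](subrK y) expRD ler_wpM2r ?expR_ge0 ?expR_ge1Dx.
have t2 : (1 + (- b - y)) * expR y <= expR (- b).
  by rewrite -[X in _ <= expR X](subrK y) expRD ler_wpM2r ?expR_ge0 ?expR_ge1Dx.
have -> : 2 * b * expR y = (b + y) * ((1 + (b - y)) * expR y) +
    (b - y) * ((1 + (- b - y)) * expR y) by ring.
by apply: lerD; apply: ler_wpM2l => //; lra.
Qed.

(** Hoeffding's lemma: [expR] lies below its chord over [-b, b], the linear part of the chord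
    averages to 0, and the constant left is cosh b. *)
Lemma expect_expR_centered (R : realType) (A : finType) (p f : A -> R) (b : R) :
  distributions p -> (forall a, `|f a| <= b) -> expect p f = 0 ->
  expect p (fun a => expR (f a)) <= expR (b ^+ 2 / 2).
Proof.
move=> [p0 p1] fb Ef.
have [a _|A0] := pickP (@predT A); last first.
  by rewrite /expect big1 ?expR_ge0// => a; have := A0 a.
have : 0 <= b by apply: le_trans (fb a).
(* The slope of the chord divides by [b], so [b = 0], where [f] vanishes, is treated apart. *)
rewrite le_eqVlt => /predU1P[b0|b0].
  rewrite /expect (eq_bigr p) ?p1 -?b0 ?expr0n/= ?mul0r ?expR0// => c _.
  by move: (fb c); rewrite -b0 normr_le0 => /eqP->; rewrite expR0 mulr1.
(* Intercept and slope of the chord: cosh b and sinh b / b. *)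
pose C := (expR b + expR (- b)) / 2; pose D := (expR b - expR (- b)) / (2 * b).
apply: (@le_trans _ _ (expect p (fun a => C + D * f a))).
  apply: ler_sum => c _; apply: ler_wpM2l => //.
  have := expR_le_chord (fb c); rewrite mulrC -ler_pdivlMr ?mulr_gt0//.
  move=> /le_trans; apply; rewrite le_eqVlt; apply/orP; left; apply/eqP.
  by rewrite /C /D; field; rewrite gt_eqF.
have -> : expect p (fun a => C + D * f a) = C.
  rewrite /expect (eq_bigr (fun a => p a * C + p a * f a * D)); last first.
    by move=> c _; ring.
  by rewrite big_split/= -!mulr_suml p1 -/(expect p f) Ef mul0r mul1r addr0.
by rewrite /C ler_pdivrMr// mulrC cosh_le_expR// ltW.
Qed.

Lemma expect_norm_le (R : realType) (A : finType) (p f : A -> R) (c : R) :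
  distributions p -> (forall a, `|f a| <= c) -> `|expect p f| <= c.
Proof.
move=> [p0 p1] fc; apply: (le_trans (ler_norm_sum _ _ _)).
rewrite -[leRHS]mul1r -p1 mulr_suml; apply: ler_sum => a _.
by rewrite normrM ger0_norm// ler_wpM2l.
Qed.

(** Centering [S] at its mean [mu] takes a factor [expR (- mu / rho)] out of the new partition
    function; after [rho * ln] it cancels the expectation of [S], and Hoeffding's lemma bounds what
    remains. *)
Lemma log_partition_step (R : realType) (A : finType) (w S : A -> R)
    (rho c : R) :
  0 < rho -> 0 < \sum_a w a -> distributions (fun a => w a / \sum_a w a) ->
  (forall a, `|S a| <= c) ->
  expect (fun a => w a / \sum_a w a) S
    + rho * ln (\sum_a w a * expR (- (1 / rho) * S a))
  <= rho * ln (\sum_a w a) + 2 * c ^+ 2 / rho.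
Proof.
set Z := \sum_a w a; set p := fun a => w a / Z => rho0 Z0 dp Sc.
set mu := expect p S.
have mgf : expect p (fun a => expR ((mu - S a) / rho)) <=
    expR ((2 * c / rho) ^+ 2 / 2).
  apply: expect_expR_centered => // [a|].
    rewrite normrM normfV (gtr0_norm rho0) ler_pM2r ?invr_gt0//.
    rewrite (le_trans (ler_normB _ _))//.
    by rewrite mulr2n mulrDl mul1r lerD// expect_norm_le.
  rewrite /expect (eq_bigr (fun a => (p a * mu - p a * S a) / rho)); last first.
    by move=> a _; rewrite mulrA mulrBr.
  by rewrite -mulr_suml sumrB -mulr_suml dp.2 mul1r -/(expect p S) subrr mul0r.
have ZE : \sum_a w a * expR (- (1 / rho) * S a) =
    Z * expR (- mu / rho) * expect p (fun a => expR ((mu - S a) / rho)).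
  rewrite /expect mulr_sumr; apply: eq_bigr => a _.
  have -> : - (1 / rho) * S a = - mu / rho + (mu - S a) / rho.
    by field; rewrite gt_eqF.
  by rewrite expRD /p; field; rewrite gt_eqF.
(* Needed to split the logarithm: a zero expectation would force every [p a] to be 0, against total
   mass 1. *)
have E0 : 0 < expect p (fun a => expR ((mu - S a) / rho)).
  rewrite lt_neqAle; apply/andP; split; last first.
    by apply: sumr_ge0 => a _; rewrite mulr_ge0 ?expR_ge0 ?(dp.1 a).
  apply/negP => /eqP; rewrite /expect => /esym/eqP.
  rewrite psumr_eq0 => [/allP h|a _]; last first.
    by rewrite mulr_ge0 ?expR_ge0 ?(dp.1 a).
  have := dp.2; rewrite big1 => [/eqP|a _]; first by rewrite eq_sym oner_eq0.
  have := h a (mem_index_enum a); rewrite /= mulf_eq0 expR_eq0 orbF.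
  by move=> /eqP.
have := mgf; rewrite -ler_ln ?posrE ?expR_gt0// expRK => lnE.
rewrite ZE lnM ?posrE ?mulr_gt0 ?expR_gt0// lnM ?posrE ?expR_gt0// expRK.
(* Hoeffding's exponent for the bound [2 * c / rho], scaled by [rho]. *)
have -> : 2 * c ^+ 2 / rho = rho * ((2 * c / rho) ^+ 2 / 2).
  by field; rewrite gt_eqF.
rewrite !mulrDr [rho * (- mu / rho)]mulrC divfK ?gt_eqF//.
by move: lnE; rewrite -(ler_pM2l rho0); lra.
Qed.

(** * Phases, histories and exponential weights *)

Lemma big_phases (V : nmodType) (tau : nat -> nat) (m : nat) (F : nat -> V) :
  \sum_(1 <= i < m.+1) \sum_(s <- phase tau i) F s =
  \sum_(1 <= s < (cumul tau m).+1) F s.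
Proof.
elim: m => [|m IH]; first by rewrite !big_geq.
(* The new phase starts at [(cumul tau m).+1], exactly where the previous range stops. *)
rewrite big_nat_recr//= IH /phase -big_cat_nat//=.
by rewrite ltnS leq_addr.
Qed.

Section ExponentialWeights.
Context {R : realType} {U : finType} (tau : nat -> nat).
Implicit Types (H : set (U -> R)).

Lemma at_time_cat (n k : nat) (h : n.-tuple (U -> R)) (g : k.-tuple (U -> R))
    (s : nat) : (0 < s <= n)%N -> at_time (cat_tuple h g) s = at_time h s.
Proof.
by case: s => // s /= sn; rewrite /at_time /= nth_cat size_tuple sn.
Qed.

Lemma at_time_mem H (n : nat) (h : n.-tuple (U -> R)) (s : nat) :
  sequences_in H h -> (0 < s <= n)%N -> H (at_time h s).
Proof.
case: s => // s Hh /= sn; have := Hh (Ordinal sn).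
by rewrite (tnth_nth (fun=> 0)).
Qed.

Lemma sequences_in_cat H (n k : nat) (h : n.-tuple (U -> R))
    (g : k.-tuple (U -> R)) :
  sequences_in H h -> sequences_in H g -> sequences_in H (cat_tuple h g).
Proof.
move=> Hh Hg i; rewrite -(splitK i); case: (fintype.split i) => j /=.
  by rewrite tnth_lshift.
by rewrite tnth_rshift.
Qed.

(** Times up to [cumul tau m] read only [h], so the new phase enters through a separate factor; this
    is the form [log_partition_step] consumes. *)
Lemma exp_weight_cat (rho : R) (m : nat) (h : (cumul tau m).-tuple (U -> R))
    (g : (tau m.+1).-tuple (U -> R)) (u : U) :
  let hg : (cumul tau m.+1).-tuple (U -> R) := cat_tuple h g in
  exp_weight rho hg u = exp_weight rho h u *
    expR (- (1 / rho) * \sum_(s <- phase tau m.+1) at_time hg s u).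
Proof.
move=> hg; rewrite /exp_weight -expRD -mulrDr big_nat_recr//=.
congr (expR (_ * (_ + _))).
rewrite !(big_phases tau m (fun s => at_time _ s u)).
by apply: eq_big_nat => s s1; rewrite at_time_cat.
Qed.

Lemma phase_sum_le H (L : R) (m : nat) (h : (cumul tau m.+1).-tuple (U -> R))
    (u : U) : (forall f, H f -> forall u, `|f u| <= L) -> sequences_in H h ->
  `|\sum_(s <- phase tau m.+1) at_time h s u| <= (tau m.+1)%:R * L.
Proof.
move=> HL Hh; apply: (le_trans (ler_norm_sum _ _ _)).
(* Exposes the phase as [tau m.+1] consecutive times starting at a positive one, so [at_time] never
   returns its default value. *)
rewrite /phase /index_iota /= subSS addKn.
apply: (@le_trans _ _ (\sum_(s <- iota (cumul tau m).+1 (tau m.+1)) L)).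
  rewrite big_seq [leRHS]big_seq; apply: ler_sum => s.
  rewrite mem_iota addSn ltnS => /andP[s1 s2].
  by apply: HL; apply: at_time_mem => //; rewrite (leq_trans _ s1).
by rewrite big_const_seq count_predT size_iota iter_addr_0 mulr_natl.
Qed.

Lemma sum_exp_weight_gt0 (rho : R) (m : nat)
    (h : (cumul tau m).-tuple (U -> R)) :
  (0 < #|U|)%N -> 0 < \sum_u exp_weight rho h u.
Proof.
move=> /card_gt0P[u _]; rewrite (bigD1 u)//= ltr_pwDl ?expR_gt0//.
by apply: sumr_ge0 => v _; exact: expR_ge0.
Qed.

(** The uniform factor [#|U|%:R^-1] cancels between numerator and denominator. *)
Lemma exp_policyE (rho : R) (m : nat) (h : (cumul tau m).-tuple (U -> R)) :
  (0 < #|U|)%N ->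
  exp_policy rho h = fun u => exp_weight rho h u / \sum_u exp_weight rho h u.
Proof.
move=> U0; apply/funext => u.
rewrite /exp_policy /expect /uniform_distribution -mulr_sumr.
by rewrite -mulf_div divff ?mul1r// invr_eq0 pnatr_eq0 -lt0n.
Qed.

Lemma exp_policy_distributions (rho : R) (m : nat)
    (h : (cumul tau m).-tuple (U -> R)) :
  (0 < #|U|)%N -> distributions (exp_policy rho h).
Proof.
move=> U0; have Z0 := sum_exp_weight_gt0 rho h U0.
rewrite exp_policyE//; split=> [u|]; first by rewrite divr_ge0 ?expR_ge0// ltW.
by rewrite -mulr_suml divff// gt_eqF.
Qed.

(** The bound holds separately for each continuation [g], by [log_partition_step] with [c] equal to
    [(tau m.+1)%:R * L]. *)
Lemma exp_policy_worst_le H (rho L : R) (M m : nat)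
    (h : (cumul tau m).-tuple (U -> R)) :
  (0 < #|U|)%N -> 0 < rho -> (forall f, H f -> forall u, `|f u| <= L) ->
  (m < M)%N -> sequences_in H h ->
  (worst_phase_value H (@exp_relaxation R U rho L M tau) h (exp_policy rho h)
   <= (exp_relaxation rho L M h)%:E)%E.
Proof.
move=> U0 rho0 HL mM Hh; apply: ge_ereal_sup => _ [g Hg <-].
rewrite lee_fin /phase_value /exp_relaxation.
set hg := cat_tuple h g.
pose S u := \sum_(s <- phase tau m.+1) at_time hg s u.
have Z0 := sum_exp_weight_gt0 rho h U0.
have Sb u : `|S u| <= (tau m.+1)%:R * L.
  by apply: (phase_sum_le (m := m) u HL); exact: sequences_in_cat.
have dp := exp_policy_distributions rho h U0.
rewrite (exp_policyE rho h)// in dp *.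
have := log_partition_step rho0 Z0 dp Sb.
rewrite (eq_bigr _ (fun u _ => exp_weight_cat rho h g u)) -/hg -/S.
(* The first term of the reserve, [j = m.+1], pays for the current phase. *)
rewrite (big_ltn (m := m.+1)) ?ltnS//.
have -> : 2 * ((tau m.+1)%:R * L) ^+ 2 / rho =
    2 * L ^+ 2 / rho * (tau m.+1)%:R ^+ 2.
  by rewrite exprMn; ring.
by rewrite mulrDr; lra.
Qed.

Lemma exp_relaxation_terminal (rho L : R) (M : nat)
    (h : (cumul tau M).-tuple (U -> R)) : 0 < rho ->
  (- ereal_inf [set (expect nu (fun u =>
                       \sum_(1 <= t < (cumul tau M).+1) at_time h t u))%:E
               | nu in @distributions R U]
   <= (exp_relaxation rho L M h)%:E)%E.
Proof.
move=> rho0; rewrite leeNl; apply: le_ereal_inf_tmp => _ [nu [nu0 nu1] <-].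
(* At [m = M] the reserve is an empty sum. As [nu] has mass 1, the bound need only be checked at
   each action [u]. *)
rewrite -EFinN lee_fin /exp_relaxation (big_geq (leqnn _)) mulr0 addr0.
rewrite -[leLHS]mul1r -nu1 mulr_suml; apply: ler_sum => u _.
rewrite ler_wpM2l// lerNl -(ler_pM2l (_ : 0 < 1 / rho)) ?divr_gt0//.
have w_le : exp_weight rho h u <= \sum_v exp_weight rho h v.
  by rewrite (bigD1 u)//= lerDl sumr_ge0// => v _; exact: expR_ge0.
have Z0 : 0 < \sum_v exp_weight rho h v.
  by apply: lt_le_trans w_le; exact: expR_gt0.
move: w_le; rewrite -ler_ln ?posrE ?expR_gt0// {1}/exp_weight expRK.
rewrite (big_phases tau M (fun s => at_time h s u)) mulNr => le_ln.
by rewrite mulrN [leRHS]mulrA div1r mulVf ?gt_eqF// mul1r -div1r.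
Qed.

End ExponentialWeights.

Lemma Q_rows_le (R : realType) (X U : finType) (F : set (X * U -> R))
    (Q : (X -> U -> R) -> (X * U -> R) -> X * U -> R) (x : X) :
  (sup_Q F Q < +oo)%E ->
  forall f, Q_rows F Q x f -> forall u, `|f u| <= fine (sup_Q F Q).
Proof.
move=> Qoo _ [P [f [MP Ff ->]]] u.
have norm_le : ((sup_norm (Q P f))%:E <= sup_Q F Q)%E.
  apply: le_ereal_sup_tmp; eexists; first by exists P.
  by apply: ereal_sup_ubound; exists f.
(* Finiteness from below comes from the real number [sup_norm (Q P f)] under the supremum; it makes
   [fine] faithful. *)
have Qfin : sup_Q F Q \is a fin_num.
  by rewrite fin_numElt Qoo andbT (lt_le_trans _ norm_le)// ltNyr.
rewrite -lee_fin fineK//; apply: le_trans norm_le; rewrite lee_fin.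
exact: (@le_bigmax _ _ _ 0 (fun a => `|Q P f a|)).
Qed.

Theorem proposition4 (R : realType) (X U : finType)
  (X_gt0 : (0 < #|X|)%N) (U_gt0 : (0 < #|U|)%N)
  (K : X -> U -> X -> R) (K_kernel : transition_kernel K)
  (inv : (X -> U -> R) -> X -> R)
  (inv_unique : forall P, @markov_matrices R X U P ->
     unique (invariant_distribution K P) (inv P))
  (F : set (X * U -> R)) (F_neq0 : F !=set0)
  (Q : (X -> U -> R) -> (X * U -> R) -> X * U -> R)
  (Q_poisson : forall P f, @markov_matrices R X U P -> F f ->
     reverse_poisson K P (inv P) f (Q P f))
  (Q_bounded : (sup_Q F Q < +oo)%E)
  (T M : nat) (T_ge1 : (1 <= T)%N)
  (tau : nat -> nat) (tau_phases : phase_lengths T M tau)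
  (rho : R) (rho_gt0 : 0 < rho) :
  let L := fine (sup_Q F Q) in
  let W := @exp_relaxation R U rho L M tau in
  [/\ forall x, admissible_relaxation (Q_rows F Q x) M W,
      forall m, (m < M)%N ->
        forall h : X -> (cumul tau m).-tuple (U -> R),
        (forall x, sequences_in (Q_rows F Q x) (h x)) ->
        @markov_matrices R X U (fun x => exp_policy rho (h x))
    & forall x m, (m < M)%N ->
        forall h : (cumul tau m).-tuple (U -> R),
        sequences_in (Q_rows F Q x) h ->
        (worst_phase_value (Q_rows F Q x) W h (exp_policy rho h)
         <= (W m h)%:E)%E].
Proof.
move=> L W; have HL x := @Q_rows_le R X U F Q x Q_bounded.
split=> [x|m mM h Hh x|x m mM h Hh].
- split=> [h Hh|m mM h Hh]; first exact: exp_relaxation_terminal.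
  (* The infimum over [nu] is at most the value at [exp_policy rho h]. *)
  apply: le_trans (exp_policy_worst_le U_gt0 rho_gt0 (HL x) mM Hh).
  apply: ereal_inf_lbound; exists (exp_policy rho h) => //.
  exact: exp_policy_distributions.
- exact: exp_policy_distributions.
- exact: (exp_policy_worst_le U_gt0 rho_gt0 (HL x)).
Qed.
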